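(* Let $W=(W_1,\ldots,W_n)$ be an injective weighted left multi-shift and let $\pi$ be a unital $*$-representation of $C^*(W)$ on a separable Hilbert space $\mathcal K$. If $V=(V_1,\ldots,V_n)$, where $V_i:=\pi(W_i)$, and $\pi$ is not a Cuntz type $*$-representation, then the $C^*$-algebras $C^*(W)$ and $C^*(V)$ are $*$-isomorphic.
   Context: Let $n\ge 1$ and let $\mathbb F_n^+$ be the unital free semigroup on generators $g_1,\ldots,g_n$ with identity $g_0$; $|\alpha|$ is the length of $\alpha$. $F^2(H_n)$ is the full Fock space, a Hilbert space with orthonormal basis $\{e_\alpha\}_{\alpha\in\mathbb F_n^+}$. The weighted left multi-shift associated with weights $\mu_\beta\ge0$ ($|\beta|\ge1$) satisfying $\sup_\alpha\mu_{g_i\alpha}<\infty$ for each $i$ is $W=(W_1,\ldots,W_n)$, $W_ie_\alpha=\mu_{g_i\alpha}e_{g_i\alpha}$; it is injective if each $W_i$ is injective, equivalently all $\mu_\beta>0$. $C^*(W)$ (resp. $C^*(V)$) is the $C^*$-algebra generated by $W_1,\ldots,W_n$ (resp. $V_1,\ldots,V_n$) and the identity. A unital $*$-representation $\pi$ of $C^*(W)$ on a separable Hilbert space $\mathcal K$ is said to be of Cuntz type if $\mathcal K_0=\{0\}$ in the Wold decomposition of $\pi$. The Wold decomposition is $\pi=\pi_0\oplus\pi_1$ on $\mathcal K=\mathcal K_0\oplus\mathcal K_1$, where $\mathcal K_0:=\overline{\mathrm{span}}\{\pi(X)\mathcal K:X\in\mathbf K(F^2(H_n))\}$, $\mathcal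 K_1:=\mathcal K_0^\perp$, and $\mathbf K(F^2(H_n))$ is the ideal of compact operators in $B(F^2(H_n))$. (This decomposition is established in the situation where $\lim_{\alpha\to\infty}(\mu_{g_i\alpha}-\mu_\alpha)=0$ for some $i$, in which case $C^*(W)$ contains all compact operators; the theorem as stated does not list this condition among its hypotheses.) *)

(* Defs.v *)
From HB Require Import structures.
From mathcomp Require Import all_boot all_order all_algebra sesquilinear.
From mathcomp Require Import complex.
From mathcomp Require Import all_classical all_reals all_analysis.

Set Implicit Arguments.
Unset Strict Implicit.
Unset Printing Implicit Defensive.

Import Order.TTheory GRing.Theory Num.Theory.
Import numFieldNormedType.Exports.

Local Open Scope classical_set_scope.
Local Open Scope ring_scope.
Local Open Scope complex_scope.

(* Complex Hilbert spaces. The inner product is linear in its first argument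
   and conjugate-linear in its second one. *)
HB.mixin Record isHilbert (R : realType) H of CompleteNormedModule R[i] H := {
  inner : {dot H for (@Num.conj R[i])} ;
  inner_norm : forall x : H, inner x x = `|x| ^+ 2
}.

#[short(type="hilbertType")]
HB.structure Definition Hilbert (R : realType) :=
  {H of isHilbert R H & CompleteNormedModule R[i] H}.

Section LinearSpan.
Variables (C : numFieldType) (V : lmodType C).

Definition is_subspace (M : set V) : Prop :=
  M 0 /\ forall (a : C) (x y : V), M x -> M y -> M (a *: x + y).

Definition lspan (G : set V) : set V := smallest is_subspace G.

End LinearSpan.

Definition separable_space (T : topologicalType) : Prop :=
  exists2 D : set T, countable D & dense D.

Section Operators.
Variables (R : realType) (H : hilbertType R).
Implicit Types (S T : H -> H) (A : set (H -> H)).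

Definition orthonormal_basis (I : eqType) (e : I -> H) : Prop :=
  (forall a b : I, inner (e a) (e b) = (a == b)%:R) /\
  closure (lspan (range e)) = setT.

Definition bounded_op T : Prop :=
  linear T /\ exists M : R[i], forall x : H, `|T x| <= M * `|x|.

(* T and S are adjoint to each other: S = T^*. *)
Definition is_adjoint T S : Prop :=
  forall x y : H, inner (T x) y = inner x (S y).

Definition compact_op T : Prop :=
  bounded_op T /\ precompact (T @` [set x | `|x| <= 1]).

(* T belongs to the closure of A for the operator norm: for every e > 0 some
   S in A satisfies ||T - S|| <= e. *)
Definition opnorm_closure A T : Prop :=
  bounded_op T /\
  forall e : R[i], 0 < e ->
    exists2 S, A S & forall x : H, `|T x - S x| <= e * `|x|.

Record unital_cstar_subalgebra A : Prop := {
  cstar_bounded : forall T, A T -> bounded_op T ;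
  cstar_id : A idfun ;
  cstar_linear : forall (a : R[i]) S T, A S -> A T -> A (a *: S + T) ;
  cstar_comp : forall S T, A S -> A T -> A (S \o T) ;
  cstar_adjoint : forall T S, A T -> bounded_op S -> is_adjoint T S -> A S ;
  cstar_closed : forall T, opnorm_closure A T -> A T
}.

Definition cstar_generated (n : nat) (W : 'I_n -> H -> H) : set (H -> H) :=
  smallest unital_cstar_subalgebra (range W).

End Operators.

(* Maps out of an operator algebra A are total functions on H -> H of which
   only the values on A matter. *)
Record star_homomorphism (R : realType) (H K : hilbertType R)
    (A : set (H -> H)) (phi : (H -> H) -> (K -> K)) : Prop := {
  star_hom_bounded : forall T, A T -> bounded_op (phi T) ;
  star_hom_linear : forall (a : R[i]) S T, A S -> A T ->
    phi (a *: S + T) = a *: phi S + phi T ;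
  star_hom_comp : forall S T, A S -> A T -> phi (S \o T) = phi S \o phi T ;
  star_hom_adjoint : forall S T, A S -> A T ->
    is_adjoint S T -> is_adjoint (phi S) (phi T)
}.

Definition unital_star_representation (R : realType) (H K : hilbertType R)
    (A : set (H -> H)) (pi : (H -> H) -> (K -> K)) : Prop :=
  star_homomorphism A pi /\ pi idfun = idfun.

Definition star_isomorphic (R : realType) (H K : hilbertType R)
    (A : set (H -> H)) (B : set (K -> K)) : Prop :=
  exists phi : (H -> H) -> (K -> K),
    star_homomorphism A phi /\ set_bij A B phi.

(* The closed span of the vectors pi(X) k, with X a compact operator in the
   domain A of pi. No containment of all compact operators in A is assumed. *)
Definition wold_K0 (R : realType) (H K : hilbertType R)
    (A : set (H -> H)) (pi : (H -> H) -> (K -> K)) : set K :=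
  closure (lspan [set v | exists X : H -> H,
    [/\ A X, compact_op X & exists k : K, v = pi X k]]).

Definition cuntz_type (R : realType) (H K : hilbertType R)
    (A : set (H -> H)) (pi : (H -> H) -> (K -> K)) : Prop :=
  wold_K0 A pi = [set 0].

(* Elements of the free semigroup on n generators are words over 'I_n: the
   identity is [::] and g_i alpha is i :: alpha. The Fock space is given by
   an orthonormal basis e indexed by words. The value mu [::] is not used. *)
Record weighted_left_multishift (R : realType) (n : nat) (F : hilbertType R)
    (e : seq 'I_n -> F) (mu : seq 'I_n -> R) (W : 'I_n -> F -> F) : Prop := {
  weight_ge0 : forall i alpha, 0 <= mu (i :: alpha) ;
  weight_bounded : forall i, has_ubound [set mu (i :: alpha) | alpha in setT] ;
  multishift_bounded : forall i, bounded_op (W i) ;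
  multishiftE : forall i alpha,
    W i (e alpha) = (mu (i :: alpha))%:C *: e (i :: alpha)
}.

Definition injective_multishift (R : realType) (n : nat) (F : hilbertType R)
    (W : 'I_n -> F -> F) : Prop := forall i, injective (W i).

(* Main.v *)
(* Idea. Since pi is not of Cuntz type, pi X <> 0 for some compact X in
   A = C^*(W). Let G be a product of factors 1 - W_i W_i^* / c with c large:
   G is a diagonal contraction in A whose eigenvalue is 1 on the vacuum vector
   e_0 and lies in [0, 1[ on the other basis vectors. The powers of G tend
   strongly to the projection P onto e_0, so they tend to it in norm against
   compact operators, and A contains P S^* X T for all S, T in A. A suitable
   choice of the words S, T in the W_i and a second passage to the limit give
   P in A. If pi P were 0, then so would be the images of all the projections
   onto basis vectors, hence pi X = 0. So pi P fixes some v <> 0, and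
   |pi(S) v| = |S e_0| |v| for S in A; as A e_0 is dense, |T| <= |pi(T)| for
   every T in A. Hence pi is injective with closed range, and this range is
   C^*(V). *)

Require Import Defs.
From mathcomp Require Import all_boot all_order all_algebra sesquilinear.
From mathcomp Require Import complex ring lra.
From mathcomp Require Import all_classical all_reals all_analysis.

Set Implicit Arguments.
Unset Strict Implicit.
Unset Printing Implicit Defensive.

Import Order.TTheory GRing.Theory Num.Theory.
Import numFieldNormedType.Exports.

Local Open Scope classical_set_scope.
Local Open Scope ring_scope.
Local Open Scope complex_scope.

(** * Hilbert spaces *)

Section RealComplex.
Variable R : realType.
Implicit Types r s : R.

Lemma rcD r s : (r + s)%:C = r%:C + s%:C.
Proof. exact: (rmorphD (real_complex R)). Qed.

Lemma rcB r s : (r - s)%:C = r%:C - s%:C.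
Proof. exact: (rmorphB (real_complex R)). Qed.

Lemma rcM r s : (r * s)%:C = r%:C * s%:C.
Proof. exact: (rmorphM (real_complex R)). Qed.

Lemma rcX r k : (r ^+ k)%:C = r%:C ^+ k.
Proof. exact: (rmorphXn (real_complex R)). Qed.

Lemma geometric_lt (c r : R) : 0 < r -> exists k, c * 2^-1 ^+ k < r.
Proof.
move=> r0; have /cvgrPdist_lt/(_ _ r0)[k _ /(_ k (leqnn k))] :
  (c * 2^-1 ^+ k @[k --> \oo] --> (0 : R)).
  rewrite -[X in _ --> X](mulr0 c).
  by apply: cvgMr; apply: cvg_expr; rewrite ger0_norm ?invr_ge0// invf_lt1// ltr1n.
by rewrite /= sub0r normrN => /(le_lt_trans (ler_norm _)) ?; exists k.
Qed.

(** Passages to the limit take this form: two vectors coincide once the norm of their difference is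
    at most [c * 2^-k] for every [k]. *)
Lemma geometric_le0 (c r : R) : (forall k, r <= c * 2^-1 ^+ k) -> r <= 0.
Proof.
move=> h; rewrite leNgt; apply/negP => /(geometric_lt c)[k].
by rewrite ltNge h.
Qed.

Lemma Re_mulr r (a : R[i]) : complex.Re (r%:C * a) = r * complex.Re a.
Proof. by case: a => u v /=; rewrite mul0r subr0. Qed.

End RealComplex.

(** * Real-valued norm, completeness and the Riesz representation theorem *)

Section HilbertNorm.
Variables (R : realType) (H : hilbertType R).
Implicit Types (x y z : H) (a : R[i]) (r : R).

(* The library norm takes real values in R[i]; nrm takes them in R. *)
Definition nrm x : R := complex.Re `|x|.
Definition rip x y : R := complex.Re (inner x y).

Lemma nrmE x : `|x| = (nrm x)%:C.
Proof. by rewrite /nrm RRe_real// ger0_real. Qed.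

Lemma nrm_ge0 x : 0 <= nrm x.
Proof. by rewrite -ler0c -nrmE. Qed.

Lemma nrm0 : nrm (0 : H) = 0.
Proof. by rewrite /nrm normr0. Qed.

Lemma nrm_eq0 x : nrm x = 0 -> x = 0.
Proof. by move=> h; apply/eqP; rewrite -normr_eq0 nrmE h. Qed.

Lemma nrmD x y : nrm (x + y) <= nrm x + nrm y.
Proof. rewrite -lecR rcD -!nrmE. exact: ler_normD. Qed.

Lemma nrmN x : nrm (- x) = nrm x.
Proof. by rewrite /nrm normrN. Qed.

Lemma nrmZ a x : nrm (a *: x) = complex.Re `|a| * nrm x.
Proof. by rewrite /nrm normrZ nrmE; case: (a) => u v; rewrite normc_def /= mul0r subr0. Qed.

Lemma nrmZr r x : 0 <= r -> nrm (r%:C *: x) = r * nrm x.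
Proof. by move=> r0; rewrite nrmZ ger0_norm ?ler0c. Qed.

Lemma innerDl x y z : inner (x + y) z = inner x z + inner y z.
Proof. by rewrite linearDl. Qed.

Lemma innerZl a x z : inner (a *: x) z = a * inner x z.
Proof. by rewrite linearZl_LR. Qed.

Lemma innerNl x z : inner (- x) z = - inner x z.
Proof. by rewrite linearNl. Qed.

Lemma inner0l z : inner 0 z = 0.
Proof. by rewrite linear0l. Qed.

Lemma innerC x y : inner x y = (inner y x)^*.
Proof. by rewrite hermC/= expr0 mul1r. Qed.

Lemma innerDr x y z : inner z (x + y) = inner z x + inner z y.
Proof. by rewrite linearDr. Qed.

Lemma innerNr x z : inner z (- x) = - inner z x.
Proof. by rewrite linearNr. Qed.

Lemma innerZr a x z : inner z (a *: x) = a^* * inner z x.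
Proof. by rewrite linearZr_LR. Qed.

Lemma innerZr_real r x z : inner z (r%:C *: x) = r%:C * inner z x.
Proof. by rewrite innerZr; congr (_ * _); exact: conjc_real. Qed.

Lemma innerxx x : inner x x = (nrm x ^+ 2)%:C.
Proof. by rewrite inner_norm nrmE rcX. Qed.

Lemma ripC x y : rip x y = rip y x.
Proof. by rewrite /rip innerC; case: (inner y x). Qed.

Lemma ripDl x y z : rip (x + y) z = rip x z + rip y z.
Proof. by rewrite /rip innerDl raddfD. Qed.

Lemma ripNl x z : rip (- x) z = - rip x z.
Proof. by rewrite /rip innerNl raddfN. Qed.

Lemma ripZl r x z : rip (r%:C *: x) z = r * rip x z.
Proof. by rewrite /rip innerZl; case: (inner x z) => u v /=; rewrite mul0r subr0. Qed.

Lemma ripxx x : rip x x = nrm x ^+ 2.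
Proof. by rewrite /rip innerxx. Qed.

Lemma nrmD_sqr x y : nrm (x + y) ^+ 2 = nrm x ^+ 2 + 2 * rip x y + nrm y ^+ 2.
Proof.
rewrite -!ripxx ripDl ![rip _ (x + y)]ripC !ripDl (ripC y x); ring.
Qed.

Lemma nrmB_sqr x y : nrm (x - y) ^+ 2 = nrm x ^+ 2 - 2 * rip x y + nrm y ^+ 2.
Proof. by rewrite nrmD_sqr nrmN ripC ripNl ripC; ring. Qed.

(** Cauchy-Schwarz for the real part, from the squared norm of [|y| x - |x| y]. *)
Lemma rip_le x y : rip x y <= nrm x * nrm y.
Proof.
have [/nrm_eq0 -> |x0] := eqVneq (nrm x) 0.
  by rewrite /rip inner0l nrm0 mul0r.
have [/nrm_eq0 -> |y0] := eqVneq (nrm y) 0.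
  by rewrite ripC /rip inner0l nrm0 mulr0.
have x1 : 0 < nrm x by rewrite lt_def x0 nrm_ge0.
have y1 : 0 < nrm y by rewrite lt_def y0 nrm_ge0.
have := sqr_ge0 (nrm ((nrm y)%:C *: x - (nrm x)%:C *: y)).
rewrite nrmB_sqr !nrmZr ?nrm_ge0// ripZl ripC ripZl ripC => h.
rewrite -(ler_pM2l (mulr_gt0 x1 y1)); nra.
Qed.

Lemma parallelogram x y :
  nrm (x - y) ^+ 2 = 2 * nrm x ^+ 2 + 2 * nrm y ^+ 2 - nrm (x + y) ^+ 2.
Proof. by rewrite nrmB_sqr nrmD_sqr; ring. Qed.

Lemma in_closure (M : set H) x :
  closure M x <-> forall r, 0 < r -> exists2 y, M y & nrm (x - y) < r.
Proof.
split => [cx r r0|h B].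
  have /(_ _)[|y [My]] := cx (ball x r%:C); first by apply: nbhsx_ballx; rewrite ltcR.
  by rewrite -ball_normE/= nrmE ltcR => ?; exists y.
case/nbhs_ballP => e e0 eB.
have [|y My yx] := h (complex.Re e).
  by move: e0; rewrite /= ltcE => /andP[_].
exists y; split => //; apply: eB; rewrite -ball_normE/= nrmE.
by rewrite -[e]RRe_real ?ltcR// gtr0_real.
Qed.

Lemma geometric_limit (u : nat -> H) (c : R) :
  (forall k, nrm (u k.+1 - u k) <= c * 2^-1 ^+ k) ->
  exists l, forall k, nrm (l - u k) <= 2 * c * 2^-1 ^+ k.
Proof.
move=> hu.
have c0 : 0 <= c by have := hu 0%N; rewrite expr0 mulr1; apply: le_trans; exact: nrm_ge0.
(* The subtracted term closes the induction: it drops by exactly [c * 2^-(k+m)] at each step. *)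
have tail k m : nrm (u (k + m)%N - u k) <= 2 * c * 2^-1 ^+ k - 2 * c * 2^-1 ^+ (k + m).
  elim: m => [|m IH]; first by rewrite addn0 !subrr nrm0.
  have -> : u (k + m.+1)%N - u k = (u (k + m).+1 - u (k + m)%N) + (u (k + m)%N - u k).
    by rewrite addnS addrA subrK.
  apply: le_trans (nrmD _ _) _; have := hu (k + m)%N.
  by rewrite addnS exprS; lra.
have tailW k m : nrm (u (k + m)%N - u k) <= 2 * c * 2^-1 ^+ k.
  apply: le_trans (tail k m) _; rewrite gerBl.
  by rewrite mulr_ge0 ?exprn_ge0 ?invr_ge0// mulr_ge0.
have /cvg_ex[l ul] : cvg (u @ \oo).
  apply/cauchy_cvgP; apply: cauchy_exP => e e0.
  have [|k ke] := @geometric_lt _ (2 * c) (complex.Re e); first by move: e0; rewrite ltcE => /andP[_].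
  exists (u k); exists k => // j /= kj.
  rewrite -ball_normE/= -opprB normrN nrmE -[e]RRe_real ?gtr0_real// ltcR.
  by rewrite -(subnKC kj); apply: le_lt_trans (tailW _ _) ke.
exists l => k; apply/ler_addgt0Pr => d d0.
have /cvgrPdist_lt/(_ d%:C)[|j _ /(_ (maxn j k))] := ul; first by rewrite ltcR.
rewrite /= leq_maxl nrmE ltcR => /(_ isT) lj.
have := nrmD (l - u (maxn j k)) (u (maxn j k) - u k).
rewrite addrA subrK; have := tailW k (maxn j k - k)%N.
by rewrite subnKC ?leq_maxr//; lra.
Qed.

Lemma totally_bounded (M : set H) r : precompact M -> 0 < r ->
  exists s : seq H, forall x, M x -> exists2 y, y \in s & nrm (x - y) <= r.
Proof.
move=> + r0; rewrite precompactE compact_cover => /(_ H setT (fun y => ball y r%:C))[].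
- by move=> y _; exact: ball_open.
- by move=> x _; exists x => //; rewrite -ball_normE/= subrr normr0 ltcR.
move=> D _ MD; exists (finmap.enum_fset D) => x Mx.
have [y Dy] := MD x (subset_closure Mx).
rewrite -ball_normE/= nrmE ltcR => xy; exists y => //.
by rewrite -nrmN opprB ltW.
Qed.

(** Variational proof: [y] is the limit of a minimising sequence of [|x|^2 - 2 Re f(x)]. The
    parallelogram law makes the sequence Cauchy, and minimality in every direction gives [Re f]. *)
Lemma riesz (f : H -> R[i]) (c : R) :
  (forall a x y, f (a *: x + y) = a * f x + f y) ->
  (forall x, complex.Re (f x) <= c * nrm x) ->
  exists y, forall x, f x = inner x y.
Proof.
move=> flin fb.
pose g x := nrm x ^+ 2 - 2 * complex.Re (f x).
have g_ge x : - c ^+ 2 <= g x.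
  by rewrite /g; have := fb x; have := sqr_ge0 (nrm x - c); nra.
pose d := inf (range g).
have ginf : has_inf (range g).
  by split; [exists (g 0), 0 | exists (- c ^+ 2) => _ [x _ <-]].
have d_le x : d <= g x by apply: (ge_inf ginf.2); exists x.
have fD x y : f (x + y) = f x + f y by rewrite -[x]scale1r flin mul1r scale1r.
have f0 : f 0 = 0 by apply: (@addrI _ (f 0)); rewrite -fD !addr0.
have fZ a x : f (a *: x) = a * f x by rewrite -[a *: x]addr0 flin f0 addr0.
have fN x : f (- x) = - f x by rewrite -scaleN1r fZ mulN1r.
have fZr r x : complex.Re (f (r%:C *: x)) = r * complex.Re (f x).
  by rewrite fZ Re_mulr.
(* An error of [4^-k] in [g] becomes, through [g_mid], a distance of order [2^-k] between successive
   terms. *)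
have /choice[u hu] : forall k, exists x, g x < d + (2^-1 ^+ k) ^+ 2.
  move=> k; have [|_ [x _ <-] ?] := @inf_adherent _ (range g) ((2^-1 ^+ k) ^+ 2) _ ginf.
    by rewrite !exprn_gt0// invr_gt0.
  by exists x.
have g_mid x y : nrm (x - y) ^+ 2 <= 2 * g x + 2 * g y - 4 * d.
  have := d_le (2^-1%:C *: (x + y)).
  by rewrite parallelogram /g nrmZr ?invr_ge0// fZr fD raddfD/=; lra.
have pow_ge0 k : 0 <= 2^-1 ^+ k :> R by rewrite exprn_ge0// invr_ge0.
have [|y hy] := @geometric_limit u 2.
  move=> k; rewrite -(@ler_pXn2r _ 2) ?nnegrE ?nrm_ge0 ?mulr_ge0//.
  have := g_mid (u k.+1) (u k); have := hu k; have := hu k.+1.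
  by rewrite !expr2 exprS; have := mulr_ge0 (pow_ge0 k) (pow_ge0 k); nra.
(* Moving [u k] by [- 2^-k z] cannot bring [g] below [d]; dividing by [2^-k], the square root of the
   error, leaves terms of order [2^-k]. *)
have hle z : rip y z - complex.Re (f z) <= 0.
  apply: (@geometric_le0 _ (4 * nrm z + (nrm z ^+ 2 + 1) / 2)) => k.
  have := d_le (u k - (2^-1 ^+ k)%:C *: z).
  rewrite /g nrmB_sqr nrmZr// ripC ripZl ripC fD fN raddfD raddfN/= fZr.
  have := hu k; rewrite /g.
  have := rip_le (y - u k) z; rewrite ripDl ripNl.
  have := ler_wpM2r (nrm_ge0 z) (hy k).
  have := pow_ge0 k; rewrite le_eqVlt => /predU1P[<-|p0]; first by nra.
  move=> h1 h2 h3 h4; rewrite -(ler_pM2r p0). nra.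
have hre z : complex.Re (f z) = rip y z.
  apply/eqP; rewrite eq_le; have := hle z; have := hle (- z).
  by rewrite fN ripC ripNl ripC raddfN/= => *; apply/andP; split; lra.
exists y => x; rewrite innerC; apply/eqP; rewrite eq_complex.
have := hre x; have := hre ('i *: x).
rewrite fZ /rip innerZr.
case: (f x) (inner y x) => [p q] [v w] /=.
by rewrite !(mul0r, mul1r, mulr0, add0r, sub0r, addr0, subr0, mulN1r, opprK, mulNr) => <- ->; rewrite opprK !eqxx.
Qed.

End HilbertNorm.

(** * Operator algebras and their representations *)

Section Operators.
Variables (R : realType) (H : hilbertType R).
Implicit Types (S T : H -> H) (A : set (H -> H)).

Lemma inner_inj (y z : H) : (forall x, inner x y = inner x z) -> y = z.
Proof.
move=> h; apply/eqP; rewrite -subr_eq0; apply/eqP/nrm_eq0/eqP.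
by rewrite -sqrf_eq0 -ripxx /rip innerDr innerNr h subrr.
Qed.

Lemma is_adjointC T S : is_adjoint T S -> is_adjoint S T.
Proof. by move=> h x y; rewrite innerC -h -innerC. Qed.

Lemma is_adjoint_unique T S S' : is_adjoint T S -> is_adjoint T S' -> S = S'.
Proof. by move=> h h'; apply: funext => y; apply: inner_inj => x; rewrite -h h'. Qed.

Lemma is_adjoint_comp T T' S S' :
  is_adjoint T S -> is_adjoint T' S' -> is_adjoint (T \o T') (S' \o S).
Proof. by move=> h h' x y; rewrite /= h h'. Qed.

Lemma rip_adjoint T S x y : is_adjoint T S -> rip (T x) y = rip x (S y).
Proof. by move=> h; rewrite /rip h. Qed.

Section LinearMaps.
Variables (K : hilbertType R) (T : H -> K).
Hypothesis lT : linear T.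

Lemma linD x y : T (x + y) = T x + T y.
Proof. by rewrite -[x]scale1r lT !scale1r. Qed.

Lemma lin0 : T 0 = 0.
Proof. by apply: (@addrI _ (T 0)); rewrite -linD !addr0. Qed.

Lemma linZ a x : T (a *: x) = a *: T x.
Proof. by rewrite -[a *: x]addr0 lT lin0 addr0. Qed.

Lemma linN x : T (- x) = - T x.
Proof. by rewrite -scaleN1r linZ scaleN1r. Qed.

Lemma linB x y : T (x - y) = T x - T y.
Proof. by rewrite linD linN. Qed.

End LinearMaps.

Lemma bounded_opP T : bounded_op T <->
  linear T /\ exists2 m : R, 0 <= m & forall x, nrm (T x) <= m * nrm x.
Proof.
split=> [[lT [M hM]]|[lT [m m0 hm]]]; split => //.
  exists `|complex.Re M| => // x.
  have := hM x; rewrite !nrmE lecE => /andP[_].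
  rewrite mulrC Re_mulr mulrC => h; apply: le_trans h _ => /=.
  by rewrite ler_wpM2r ?nrm_ge0// ler_norm.
by exists m%:C => x; rewrite !nrmE -rcM lecR.
Qed.

Lemma bounded_linear T : bounded_op T -> linear T.
Proof. by case. Qed.

Lemma opnorm_closureP A T : opnorm_closure A T <->
  bounded_op T /\ forall r : R, 0 < r ->
    exists2 S, A S & forall x, nrm (T x - S x) <= r * nrm x.
Proof.
split=> [[bT h]|[bT h]]; split => // r r0.
  have [|S AS hS] := h r%:C; first by rewrite ltcR.
  by exists S => // x; rewrite -lecR rcM -!nrmE.
have er : r = (complex.Re r)%:C by rewrite RRe_real// gtr0_real.
have [|S AS hS] := h (complex.Re r); first by rewrite -ltcR -er.
by exists S => // x; rewrite er !nrmE -rcM lecR.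
Qed.

Lemma bounded_id : bounded_op (@idfun H).
Proof. by apply/bounded_opP; split => //; exists 1 => // x; rewrite mul1r. Qed.

Lemma bounded_lincomb (a : R[i]) S T :
  bounded_op S -> bounded_op T -> bounded_op (a *: S + T).
Proof.
move=> /bounded_opP[lS [m m0 hm]] /bounded_opP[lT [p p0 hp]]; apply/bounded_opP; split.
  move=> b x y; rewrite !fctE lS lT !scalerDr !scalerA addrACA [a * b]mulrC.
  by congr (_ + _).
have a0 : 0 <= complex.Re `|a|.
  by have := normr_ge0 a; rewrite lecE => /andP[].
exists (complex.Re `|a| * m + p) => [|x]; first by rewrite addr_ge0 ?mulr_ge0.
rewrite !fctE; apply: le_trans (nrmD _ _) _; rewrite nrmZ mulrDl lerD//.
by rewrite -mulrA ler_wpM2l//.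
Qed.

Lemma bounded_comp S T : bounded_op S -> bounded_op T -> bounded_op (S \o T).
Proof.
move=> /bounded_opP[lS [m m0 hm]] /bounded_opP[lT [p p0 hp]]; apply/bounded_opP; split.
  by move=> a x y; rewrite /= lT lS.
exists (m * p) => [|x]; first exact: mulr_ge0.
by rewrite /= -mulrA; apply: le_trans (hm _) _; rewrite ler_wpM2l.
Qed.

(** [|S y|^2 = Re <T S y, y>] is at most [m |S y| |y|]; divide by [|S y|]. *)
Lemma adjoint_bound T S m : is_adjoint T S ->
  (forall x, nrm (T x) <= m * nrm x) -> forall y, nrm (S y) <= m * nrm y.
Proof.
move=> adj hm y.
have [->|Sy] := eqVneq (nrm (S y)) 0.
  by apply: le_trans (hm y); exact: nrm_ge0.
have Sy0 : 0 < nrm (S y) by rewrite lt_def Sy nrm_ge0.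
rewrite -(ler_pM2l Sy0) -expr2 -ripxx -(rip_adjoint _ _ adj).
apply: le_trans (rip_le _ _) _.
by rewrite mulrA [nrm (S y) * m]mulrC ler_wpM2r// nrm_ge0.
Qed.

Lemma adjoint_linear T S : is_adjoint T S -> linear S.
Proof.
by move=> adj a x y; apply: inner_inj => z; rewrite innerDr innerZr -!adj innerDr innerZr.
Qed.

Lemma adjoint_exists T : bounded_op T -> exists2 S, bounded_op S & is_adjoint T S.
Proof.
move=> /bounded_opP[lT [m m0 hm]].
have /choice[S hS] : forall y, exists s, forall x, inner (T x) y = inner x s.
  move=> y; apply: (@riesz _ _ _ (m * nrm y)) => [a u v|x].
    by rewrite lT innerDl innerZl.
  apply: le_trans (rip_le _ _) _; rewrite mulrAC.
  by rewrite ler_wpM2r// nrm_ge0.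
have adj : is_adjoint T S by move=> x y.
exists S => //; apply/bounded_opP; split; first exact: adjoint_linear adj.
by exists m => //; apply: adjoint_bound adj hm.
Qed.

(** [cstar_generated] is an intersection: its elements are bounded because this algebra is among
    those intersected. *)
Lemma bounded_ops_cstar : unital_cstar_subalgebra (@bounded_op R H).
Proof.
split => //.
- exact: bounded_id.
- exact: bounded_lincomb.
- exact: bounded_comp.
- by move=> T [].
Qed.

Lemma cstar_generated_cstar n (W : 'I_n -> H -> H) :
  (forall i, bounded_op (W i)) -> unital_cstar_subalgebra (cstar_generated W).
Proof.
move=> bW; split.
- move=> T /(_ (@bounded_op R H)); apply; split; first exact: bounded_ops_cstar.
  by move=> _ [i _ <-].
- by move=> B [cB _]; exact: cstar_id.
- by move=> a S T AS AT B hB; apply: (cstar_linear hB.1); [exact: AS|exact: AT].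
- by move=> S T AS AT B hB; apply: (cstar_comp hB.1); [exact: AS|exact: AT].
- by move=> T S AT bS adj B hB; apply: (cstar_adjoint hB.1) bS adj; exact: AT.
- move=> T /opnorm_closureP[bT hT] B hB; apply: (cstar_closed hB.1).
  apply/opnorm_closureP; split => // r /hT[S AS hS]; exists S => //; exact: AS.
Qed.

Lemma cstar_generated_gen n (W : 'I_n -> H -> H) i : cstar_generated W (W i).
Proof. by move=> B [_]; apply; exists i. Qed.

(** Norm completeness of the bounded operators, used to sum the Neumann series and to lift Cauchy
    sequences through [pi]. *)
Lemma operator_limit (T : nat -> H -> H) (c : R) :
  (forall k, bounded_op (T k)) ->
  (forall k x, nrm (T k.+1 x - T k x) <= c * 2^-1 ^+ k * nrm x) ->
  exists2 L, bounded_op L & forall k x, nrm (L x - T k x) <= 2 * c * 2^-1 ^+ k * nrm x.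
Proof.
move=> bT hT.
have /choice[L hL] : forall x, exists l, forall k,
    nrm (l - T k x) <= 2 * (c * nrm x) * 2^-1 ^+ k.
  move=> x; apply: geometric_limit => k.
  by rewrite mulrAC; exact: hT.
have hL' k x : nrm (L x - T k x) <= 2 * c * 2^-1 ^+ k * nrm x.
  by have := hL x k; congr (_ <= _); ring.
exists L => //; apply/bounded_opP; split.
  move=> a x y; apply/eqP; rewrite -subr_eq0; apply/eqP/nrm_eq0/eqP.
  rewrite eq_le nrm_ge0 andbT.
  apply: (@geometric_le0 _ (2 * c * (nrm (a *: x + y) + complex.Re `|a| * nrm x + nrm y))) => k.
  have -> : L (a *: x + y) - (a *: L x + L y) =
    (L (a *: x + y) - T k (a *: x + y)) + (- (a *: (L x - T k x)) - (L y - T k y)).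
    by rewrite (bounded_linear (bT k)) scalerBr -opprD addrACA -opprD opprB addrA subrK.
  apply: le_trans (nrmD _ _) _.
  have := nrmD (- (a *: (L x - T k x))) (- (L y - T k y)); rewrite !nrmN nrmZ.
  have a0 : 0 <= complex.Re `|a|.
    by have := normr_ge0 a; rewrite lecE => /andP[].
  have := ler_wpM2l a0 (hL' k x); have := hL' k y; have := hL' k (a *: x + y); lra.
have /bounded_opP[_ [m m0 hm]] := bT 0%N.
have c2 : 0 <= `|2 * c| + m by rewrite addr_ge0.
exists (`|2 * c| + m) => // x.
have := nrmD (L x - T 0%N x) (T 0%N x); rewrite subrK => h; apply: le_trans h _.
rewrite mulrDl lerD//; apply: le_trans (hL' _ _) _.
by rewrite expr0 mulr1 ler_wpM2r ?nrm_ge0// ler_norm.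
Qed.

(** The partial sums [1 + T + ... + T^k] converge in norm inside [A]. A left inverse is the form
    from which [pi] yields a lower bound on [1 - pi T]. *)
Lemma neumann A T : unital_cstar_subalgebra A -> A T ->
  (forall x, nrm (T x) <= 2^-1 * nrm x) ->
  exists2 Y, A Y & Y \o ((-1) *: T + idfun) = idfun.
Proof.
move=> cA AT hT.
pose fix S k := if k is k'.+1 then 1 *: (S k' \o T) + idfun else @idfun H.
have SE k x : S k.+1 x = S k (T x) + x by rewrite /= !fctE scale1r.
have AS k : A (S k).
  elim: k => [|k IH]; first exact: cstar_id.
  by apply: cstar_linear => //; [exact: cstar_comp|exact: cstar_id].
have hS k x : nrm (S k.+1 x - S k x) <= 1 * 2^-1 ^+ k * nrm x.
  elim: k x => [|k IH] x.
    rewrite SE /= addrK expr0 !mul1r; apply: le_trans (hT x) _.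
    by rewrite ler_piMl ?nrm_ge0// invf_le1// ler1n.
  have -> : S k.+2 x - S k.+1 x = S k.+1 (T x) - S k (T x).
    by rewrite !SE opprD addrACA subrr addr0.
  apply: le_trans (IH _) _; rewrite exprSr !mul1r -mulrA ler_wpM2l//.
have [Y bY hY] := operator_limit (fun k => cstar_bounded cA (AS k)) hS.
have lY := bounded_linear bY.
exists Y.
  apply: (cstar_closed cA); apply/opnorm_closureP; split => // r r0.
  have [k hk] := geometric_lt (2 * 1) r0.
  exists (S k) => // x; apply: le_trans (hY k x) _.
  by rewrite ler_wpM2r ?nrm_ge0// ltW.
apply: funext => x; rewrite /= !fctE scaleN1r addrC linB//.
apply/eqP; rewrite -subr_eq0; apply/eqP/nrm_eq0/eqP.
rewrite eq_le nrm_ge0 andbT.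
apply: (@geometric_le0 _ (2 * (nrm x + nrm (T x)))) => k.
have -> : Y x - Y (T x) - x = (Y x - S k.+1 x) - (Y (T x) - S k (T x)).
  by rewrite SE opprD opprB [- S k (T x) - x]addrC !addrA subrK addrAC.
apply: le_trans (nrmD _ _) _; rewrite nrmN.
have := hY k (T x); have := hY k.+1 x; rewrite exprS.
have : 0 <= 2^-1 ^+ k * nrm x by rewrite mulr_ge0 ?nrm_ge0 ?exprn_ge0 ?invr_ge0.
lra.
Qed.

(** Let [N] be the square of the norm of [h]. It is an approximate eigenvalue of [h^2]: were
    [1 - h^2 / N] bounded below, [N] could be lowered. So [N] cannot exceed [q]. *)
Lemma selfadjoint_bound (h : H -> H) (q : R) : bounded_op h -> is_adjoint h h -> 0 <= q ->
  (forall N, q < N -> exists y : R, forall x,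
     nrm x <= y * nrm (x - (N^-1)%:C *: h (h x))) ->
  forall x, nrm (h x) ^+ 2 <= q * nrm x ^+ 2.
Proof.
move=> /bounded_opP[lh [m m0 hm]] adj q0 hinv.
pose B := [set r : R | 0 <= r /\ forall x, nrm (h x) ^+ 2 <= r * nrm x ^+ 2].
have hB : has_inf B.
  split; last by exists 0 => r [].
  exists (m ^+ 2); split; first exact: sqr_ge0.
  by move=> x; rewrite -exprMn ler_pXn2r ?nnegrE ?mulr_ge0 ?nrm_ge0.
pose N := inf B.
have BN : B N.
  split; first by apply: lb_le_inf hB.1 _ => r [].
  move=> x; apply/ler_addgt0Pr => e e0.
  have e1 : 0 < e / (nrm x ^+ 2 + 1) by rewrite divr_gt0// ltr_wpDl// sqr_ge0.
  have [r [r0 hr]] := inf_adherent e1 hB.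
  rewrite -/N => rN; apply: le_trans (hr x) _.
  have : r * nrm x ^+ 2 <= (N + e / (nrm x ^+ 2 + 1)) * nrm x ^+ 2.
    by rewrite ler_wpM2r ?sqr_ge0// ltW.
  move=> h1; apply: le_trans h1 _; rewrite mulrDl lerD2l.
  rewrite mulrAC ler_pdivrMr ?ltr_wpDl ?sqr_ge0//.
  by rewrite ler_wpM2l ?ltW// ltrDl.
have [Nq x|qN] := leP N q.
  by apply: le_trans (BN.2 x) _; rewrite ler_wpM2r ?sqr_ge0.
have [y hy] := hinv _ qN.
have N0 : 0 < N by apply: le_lt_trans qN.
(* Adding 1 puts [1 - Y^-1] in [[0, 1[] whatever the sign and size of [y]. *)
pose Y := y ^+ 2 + 1.
have Y1 : 1 <= Y by rewrite /Y lerDr sqr_ge0.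
have Y0 : 0 < Y by apply: lt_le_trans Y1.
have : B (N * (1 - Y^-1)).
  split; first by rewrite mulr_ge0 ?(ltW N0)// subr_ge0 invf_le1.
  move=> x; have := hy x; set w := x - _ => hw.
  (* Expand the square and use [|h (h x)|^2 <= N |h x|^2], valid since the infimum is attained. *)
  have w2 : nrm w ^+ 2 <= nrm x ^+ 2 - N^-1 * nrm (h x) ^+ 2.
    rewrite /w nrmB_sqr nrmZr ?invr_ge0 ?(ltW N0)//.
    rewrite ripC ripZl ripC -(rip_adjoint _ _ adj) ripxx exprMn.
    have := ler_wpM2l (sqr_ge0 N^-1) (BN.2 (h x)).
    have -> : N^-1 ^+ 2 * (N * nrm (h x) ^+ 2) = N^-1 * nrm (h x) ^+ 2.
      by field; rewrite gt_eqF.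
    lra.
  have x2 : nrm x ^+ 2 <= y ^+ 2 * nrm w ^+ 2.
    by rewrite -exprMn; apply: lerXn2r; rewrite ?nnegrE ?nrm_ge0// (le_trans _ hw) ?nrm_ge0.
  have : nrm x ^+ 2 <= Y * (nrm x ^+ 2 - N^-1 * nrm (h x) ^+ 2).
    apply: le_trans (ler_wpM2l (ltW Y0) w2); rewrite /Y mulrDl mul1r.
    by apply: le_trans x2 _; rewrite lerDl sqr_ge0.
  rewrite -(ler_pM2l N0) => h1; rewrite -(ler_pM2l Y0); move: h1.
  have -> : Y * (N * (1 - Y^-1) * nrm x ^+ 2) = N * Y * nrm x ^+ 2 - N * nrm x ^+ 2.
    by field; rewrite gt_eqF.
  have -> : N * (Y * (nrm x ^+ 2 - N^-1 * nrm (h x) ^+ 2)) =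
    N * Y * nrm x ^+ 2 - Y * nrm (h x) ^+ 2 by field; rewrite gt_eqF.
  lra.
move=> /(ge_inf hB.2); rewrite -/N leNgt => /negP[].
by rewrite gtr_pMr// gtrDl oppr_lt0 invr_gt0.
Qed.

End Operators.

(** * Continuity of star representations *)

Section StarHomomorphism.
Variables (R : realType) (H K : hilbertType R) (A : set (H -> H)).
Variable pi : (H -> H) -> (K -> K).
Hypotheses (cA : unital_cstar_subalgebra A) (hpi : unital_star_representation A pi).

Lemma rep_comp S T : A S -> A T -> pi (S \o T) = pi S \o pi T.
Proof. exact: (star_hom_comp hpi.1). Qed.

Lemma rep_sub S T : A S -> A T -> A ((-1) *: S + T) /\
  forall x, pi ((-1) *: S + T) x = pi T x - pi S x.
Proof.
move=> AS AT; split=> [|x]; first exact: (cstar_linear cA).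
by rewrite (star_hom_linear hpi.1)// !fctE scaleN1r addrC.
Qed.

Lemma cstar_scale (a : R[i]) T : A T -> A (a *: T).
Proof.
move=> AT; have A0 : A ((-1) *: T + T) by exact: (cstar_linear cA).
by have := cstar_linear cA a AT A0; rewrite scaleN1r addNr addr0.
Qed.

Lemma rep_scale (a : R[i]) T : A T -> pi (a *: T) = a *: pi T.
Proof.
move=> AT; have A0 : A ((-1) *: T + T) by exact: (cstar_linear cA).
have := star_hom_linear hpi.1 a AT A0.
by rewrite [pi (-1 *: T + T)](star_hom_linear hpi.1)// scaleN1r addNr addr0 scaleN1r addNr addr0.
Qed.

(* For h = pi (S^* S) and N > 2 m^4, the operator 1 - N^-1 (S^* S)^2 is
   invertible in A by the Neumann series, so N^-1 h^2 does not have 1 as an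
   approximate eigenvalue. *)
Lemma rep_bound S (m : R) : A S -> 0 <= m -> (forall x, nrm (S x) <= m * nrm x) ->
  forall x, nrm (pi S x) <= 2 * m * nrm x.
Proof.
move=> AS m0 hm.
have [S' bS' adj] := adjoint_exists (cstar_bounded cA AS).
have AS' := cstar_adjoint cA AS bS' adj.
have AT := cstar_comp cA AS' AS.
have ATT := cstar_comp cA AT AT.
have padj : is_adjoint (pi S) (pi S') by exact: (star_hom_adjoint hpi.1).
set T := S' \o S in AT ATT.
have hT x : nrm (T x) <= m ^+ 2 * nrm x.
  apply: le_trans (adjoint_bound adj hm _) _.
  by rewrite expr2 -mulrA ler_wpM2l//.
(* [T \o T] has norm at most [m ^+ 4]; the factor 2 makes its quotient by [N] at most 1/2, as the
   Neumann series requires. *)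
have q0 : 0 <= 2 * m ^+ 4 by rewrite mulr_ge0 ?exprn_ge0.
have bh := star_hom_bounded hpi.1 AT.
have hE : pi T = pi S' \o pi S by exact: rep_comp.
have adjh : is_adjoint (pi T) (pi T).
  by rewrite hE; apply: is_adjoint_comp => //; exact: is_adjointC.
have hb : forall x, nrm (pi T x) ^+ 2 <= 2 * m ^+ 4 * nrm x ^+ 2.
  apply: selfadjoint_bound => // N qN.
  have N0 : 0 < N by apply: le_lt_trans qN.
  have AZ : A ((N^-1)%:C *: (T \o T)) by exact: cstar_scale.
  have [x|Y AY YE] := neumann cA AZ.
    rewrite !fctE nrmZr ?invr_ge0 ?(ltW N0)// mulrC ler_pdivrMr//.
    apply: le_trans (hT _) _; have := ler_wpM2l (sqr_ge0 m) (hT x).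
    by have := ler_wpM2r (nrm_ge0 x) (ltW qN); lra.
  have [AW WE] := rep_sub AZ (cstar_id cA).
  have /bounded_opP[_ [y y0 hy]] := star_hom_bounded hpi.1 AY.
  exists y => x.
  have := hy (pi ((-1) *: ((N^-1)%:C *: (T \o T)) + idfun) x).
  rewrite -[X in nrm X]/((pi Y \o pi _) x) -rep_comp// YE hpi.2 WE hpi.2.
  by rewrite rep_scale// rep_comp.
move=> x.
have x0 := nrm_ge0 x.
(* Fourth powers join the two estimates: [|pi S x|^4 <= |pi T x|^2 |x|^2 <= 2 m^4 |x|^4], which is
   at most [16 m^4 |x|^4]. *)
rewrite -(@ler_pXn2r _ 4) ?nnegrE ?nrm_ge0 ?mulr_ge0//.
have h2 : nrm (pi S x) ^+ 2 <= nrm (pi T x) * nrm x.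
  by rewrite -ripxx (rip_adjoint _ _ padj) ripC hE; exact: rip_le.
have h4 : nrm (pi S x) ^+ 4 <= (nrm (pi T x) * nrm x) ^+ 2.
  by rewrite (exprM _ 2 2) lerXn2r ?nnegrE ?sqr_ge0// mulr_ge0 ?nrm_ge0.
apply: le_trans h4 _; rewrite exprMn.
apply: le_trans (ler_wpM2r (sqr_ge0 _) (hb x)) _.
by have := exprn_ge0 4 (mulr_ge0 m0 x0); lra.
Qed.

End StarHomomorphism.

(** * Strong convergence, compact operators and rank-one projections *)

Section PointwiseLimits.
Variables (R : realType) (H : hilbertType R).

Definition tends0 (T : nat -> H -> H) (x : H) :=
  forall r : R, 0 < r -> exists N, forall k, (N <= k)%N -> nrm (T k x) <= r.

(** For nonzero [x], some [y] in the span has [|x - y| < |x|], which contradicts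
    [|x|^2 = <x, x - y> <= |x| |x - y|]. *)
Lemma dense_orthogonal (G : set H) x : closure (lspan G) = setT ->
  (forall g, G g -> inner x g = 0) -> x = 0.
Proof.
move=> dG xG; apply/nrm_eq0/eqP; rewrite eq_le nrm_ge0 andbT leNgt; apply/negP => x0.
have : closure (lspan G) x by rewrite dG.
move/in_closure => /(_ _ x0)[y Gy xy].
have xy0 : inner x y = 0.
  (* [lspan] is an intersection, so membership eliminates into any subspace containing [G], here the
     orthogonal of [x]. *)
  apply: (Gy [set y | inner x y = 0]); split => //; split=> [|a u v /= xu xv].
    by rewrite /= innerC inner0l conjc0.
  by rewrite innerDr innerZr xu xv mulr0 addr0.
have : nrm x ^+ 2 <= nrm x * nrm (x - y).
  apply: le_trans (rip_le _ _); rewrite [rip _ (x - y)]ripC ripDl ripNl ripxx ripC.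
  by rewrite [rip x y]/rip xy0 subr0.
by rewrite expr2 ler_pM2l// leNgt xy.
Qed.

(** The uniform bound [C] carries convergence from the span of [G] to its closure. *)
Lemma tends0_dense (T : nat -> H -> H) (C : R) (G : set H) :
  (forall k, linear (T k)) -> (forall k x, nrm (T k x) <= C * nrm x) ->
  closure (lspan G) = setT -> (forall g, G g -> tends0 T g) -> forall x, tends0 T x.
Proof.
move=> lT hT dG TG x r r0.
have C0 : 0 < `|C| + 1 by rewrite ltr_wpDl.
have e0 : 0 < r / 2 / (`|C| + 1) by rewrite !divr_gt0.
have : closure (lspan G) x by rewrite dG.
move/in_closure => /(_ _ e0)[y Gy xy].
have Ty : tends0 T y.
  apply: (Gy (tends0 T)); split => //; split=> [s s0|a u v hu hv s s0].
    by exists 0%N => k _; rewrite (lin0 (lT k)) nrm0 ltW.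
  have a0 : 0 <= complex.Re `|a| by have := normr_ge0 a; rewrite lecE => /andP[].
  have [|N1 hN1] := hu (s / 2 / (complex.Re `|a| + 1)).
    by rewrite !divr_gt0// ltr_wpDl.
  have [|N2 hN2] := hv (s / 2); first by rewrite divr_gt0.
  exists (maxn N1 N2) => k; rewrite geq_max => /andP[/hN1 h1 /hN2 h2].
  rewrite lT; apply: le_trans (nrmD _ _) _; rewrite nrmZ.
  have : complex.Re `|a| * nrm (T k u) <= s / 2.
    apply: le_trans (ler_wpM2l a0 h1) _.
    by rewrite mulrA ler_pdivrMr ?ltr_wpDl// mulrC ler_wpM2l ?divr_ge0 ?ltW// ltrDl.
  lra.
have [|N hN] := Ty (r / 2); first by rewrite divr_gt0.
exists N => k /hN h.
have := nrmD (T k (x - y)) (T k y); rewrite -(linD (lT k)) subrK => h1.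
apply: le_trans h1 _; rewrite [r]splitr lerD//.
apply: le_trans (hT _ _) _.
move: xy; rewrite ltr_pdivlMr// => xy.
apply: le_trans (ltW xy); rewrite mulrC ler_wpM2l ?nrm_ge0//.
by have := ler_norm C; lra.
Qed.

(** A uniformly bounded sequence tending strongly to 0 does so uniformly on precompact sets: control
    it on a finite net of the image of the unit ball under [X]. *)
Lemma tends0_compact (T : nat -> H -> H) (C : R) (X : H -> H) :
  (forall k, linear (T k)) -> (forall k x, nrm (T k x) <= C * nrm x) ->
  (forall x, tends0 T x) -> compact_op X ->
  forall r : R, 0 < r -> exists k, forall x, nrm (T k (X x)) <= r * nrm x.
Proof.
move=> lT hT T0 [[lX _] cX] r r0.
have C0 : 0 < `|C| + 1 by rewrite ltr_wpDl.
have e0 : 0 < r / 2 / (`|C| + 1) by rewrite !divr_gt0.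
have [s hs] := totally_bounded cX e0.
have [N hN] : exists N, forall k, (N <= k)%N -> forall y, y \in s -> nrm (T k y) <= r / 2.
  elim: s {hs} => [|y s [N hN]]; first by exists 0%N.
  have [|N' hN'] := T0 y (r / 2); first by rewrite divr_gt0.
  exists (maxn N N') => k; rewrite geq_max => /andP[/hN h1 /hN' h2] z.
  by rewrite inE => /predU1P[->|/h1].
exists N => x.
have [x0|x0] := eqVneq (nrm x) 0.
  by rewrite (nrm_eq0 x0) (lin0 lX) (lin0 (lT N)) !nrm0 mulr0.
have xgt : 0 < nrm x by rewrite lt_def x0 nrm_ge0.
pose u := (nrm x)^-1%:C *: x.
have xu : x = (nrm x)%:C *: u by rewrite scalerA -rcM mulfV// scale1r.
have u1 : nrm u = 1 by rewrite nrmZr ?invr_ge0 ?nrm_ge0// mulVf.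
have [|y ys uy] := hs (X u); first by exists u => //=; rewrite nrmE u1.
rewrite {1}xu (linZ lX) (linZ (lT N)) nrmZr ?nrm_ge0// mulrC ler_pM2r//.
have := nrmD (T N (X u - y)) (T N y); rewrite -(linD (lT N)) subrK => h1.
apply: le_trans h1 _; rewrite [r]splitr.
apply: lerD (hN N (leqnn N) y ys).
apply: le_trans (hT _ _) _.
move: uy; rewrite ler_pdivlMr// => uy.
apply: le_trans uy; rewrite mulrC ler_wpM2l ?nrm_ge0//.
by have := ler_norm C; lra.
Qed.

(** In the expansion [|x|^2 - 2 |S x|^2 / c + |T S x|^2 / c^2] the last term is at most
    [|S x|^2 / c]. *)
Lemma adjoint_contraction (T S : H -> H) (m c : R) : is_adjoint T S -> 0 < c -> m ^+ 2 <= c ->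
  0 <= m -> (forall x, nrm (T x) <= m * nrm x) ->
  forall x, nrm (x - c^-1%:C *: T (S x)) <= nrm x.
Proof.
move=> adj c0 mc m0 hm x.
rewrite -(@ler_pXn2r _ 2) ?nnegrE ?nrm_ge0// nrmB_sqr nrmZr ?invr_ge0 ?(ltW c0)//.
rewrite ripC ripZl (rip_adjoint _ _ adj) ripxx exprMn.
have h1 : nrm (T (S x)) ^+ 2 <= c * nrm (S x) ^+ 2.
  apply: le_trans (_ : (m * nrm (S x)) ^+ 2 <= _).
    by rewrite lerXn2r ?nnegrE ?mulr_ge0 ?nrm_ge0.
  by rewrite exprMn ler_wpM2r ?sqr_ge0.
have := ler_wpM2l (sqr_ge0 c^-1) h1.
have -> : c^-1 ^+ 2 * (c * nrm (S x) ^+ 2) = c^-1 * nrm (S x) ^+ 2.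
  by field; rewrite gt_eqF.
have : 0 <= c^-1 * nrm (S x) ^+ 2 by rewrite mulr_ge0 ?sqr_ge0 ?invr_ge0 ?ltW.
lra.
Qed.

(** The orthogonal projection onto the line of [v] when [v] has norm 1. *)
Definition line_proj (v x : H) : H := inner x v *: v.

Lemma line_proj_adjoint v : is_adjoint (line_proj v) (line_proj v).
Proof.
by move=> x y; rewrite /line_proj innerZl innerZr [inner v y]innerC mulrC.
Qed.

Lemma line_proj_linear v : linear (line_proj v).
Proof. by move=> a x y; rewrite /line_proj innerDl innerZl scalerDl scalerA. Qed.

Lemma line_projK v x : nrm v = 1 -> line_proj v (line_proj v x) = line_proj v x.
Proof. by move=> v1; rewrite /line_proj innerZl innerxx v1 expr1n mulr1. Qed.

Lemma line_proj_rip v x : nrm v = 1 -> rip x (line_proj v x) = nrm (line_proj v x) ^+ 2.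
Proof.
by move=> v1; rewrite -ripxx (rip_adjoint _ _ (line_proj_adjoint v)) line_projK.
Qed.

Lemma line_proj_le v x : nrm v = 1 -> nrm (line_proj v x) <= nrm x.
Proof.
move=> v1; rewrite -(@ler_pXn2r _ 2) ?nnegrE ?nrm_ge0//.
by have := sqr_ge0 (nrm (x - line_proj v x)); rewrite nrmB_sqr line_proj_rip//; lra.
Qed.

Lemma line_projC_le v x : nrm v = 1 -> nrm (x - line_proj v x) <= nrm x.
Proof.
move=> v1; rewrite -(@ler_pXn2r _ 2) ?nnegrE ?nrm_ge0//.
by have := sqr_ge0 (nrm (line_proj v x)); rewrite nrmB_sqr line_proj_rip//; lra.
Qed.

Lemma bounded_line_proj v : nrm v = 1 -> bounded_op (line_proj v).
Proof.
move=> v1; apply/bounded_opP; split; first exact: line_proj_linear.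
by exists 1 => // x; rewrite mul1r line_proj_le.
Qed.

End PointwiseLimits.

(** * The vacuum projection *)

Section WeightedShift.
Variables (R : realType) (n : nat) (F : hilbertType R) (e : seq 'I_n -> F).
Variables (mu : seq 'I_n -> R) (W : 'I_n -> F -> F).
Hypotheses (he : orthonormal_basis e) (hW : weighted_left_multishift e mu W).
Hypothesis hWinj : injective_multishift W.

Local Notation A := (cstar_generated W).
Local Notation P := (fun a => line_proj (e a)).

Lemma shift_cstar : unital_cstar_subalgebra A.
Proof. exact: cstar_generated_cstar (multishift_bounded hW). Qed.

Let cA := shift_cstar.

Lemma nrm_basis a : nrm (e a) = 1.
Proof.
have := he.1 a a; rewrite innerxx eqxx => /(congr1 (@complex.Re R))/= /eqP.
by rewrite sqrf_eq1 => /orP[/eqP//|/eqP h]; have := nrm_ge0 (e a); rewrite h ler0N1.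
Qed.

Lemma basis_neq0 a : e a != 0.
Proof. by apply/eqP => h; have /eqP := nrm_basis a; rewrite h nrm0 eq_sym oner_eq0. Qed.

Lemma basis_ext x y : (forall a, inner x (e a) = inner y (e a)) -> x = y.
Proof.
move=> h; apply/eqP; rewrite -subr_eq0; apply/eqP.
apply: (dense_orthogonal he.2) => _ [a _ <-].
by rewrite innerDl innerNl h subrr.
Qed.

Lemma weight_gt0 i a : 0 < mu (i :: a).
Proof.
rewrite lt_def (weight_ge0 hW) andbT; apply/eqP => h.
have : W i (e a) = W i 0.
  by rewrite (multishiftE hW) h scale0r (lin0 (bounded_linear (multishift_bounded hW i))).
by move/hWinj/eqP; rewrite (negPf (basis_neq0 a)).
Qed.

Lemma gen_mem i : A (W i).
Proof. exact: cstar_generated_gen. Qed.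

(** Cyclicity of the vacuum: take the word in the [W i] that spells [a], divided by the weights met
    on the way. *)
Lemma word_operator a : exists2 S, A S & S (e [::]) = e a.
Proof.
elim: a => [|i a [S AS Se]]; first by exists idfun => //; exact: cstar_id.
exists ((mu (i :: a))^-1%:C *: (W i \o S)).
  by apply: (cstar_scale cA); apply: (cstar_comp cA) => //; exact: gen_mem.
rewrite !fctE Se (multishiftE hW) scalerA -rcM mulVf ?scale1r//.
by rewrite gt_eqF// weight_gt0.
Qed.

(** The factor is [1 - W_i S / c] with [S] the adjoint of [W_i]. It fixes [e a] unless [a] begins
    with [i], where the eigenvalue drops by [mu a ^+ 2 / c]. *)
Lemma diag_factor i : exists (G : F -> F) (g : seq 'I_n -> R),
  [/\ A G, forall x, nrm (G x) <= nrm x, forall a, G (e a) = (g a)%:C *: e a,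
      forall a, 0 <= g a <= 1 &
      g [::] = 1 /\ forall a, g (i :: a) < 1].
Proof.
have [S bS adj] := adjoint_exists (multishift_bounded hW i).
have AS := cstar_adjoint cA (gen_mem i) bS adj.
have /bounded_opP[lW [m m0 hm]] := multishift_bounded hW i.
(* Positive even for [m = 0], and at least every [mu (i :: a) ^+ 2]. *)
pose c := m ^+ 2 + 1.
have c0 : 0 < c by rewrite ltr_wpDl// sqr_ge0.
have mu_le a : mu (i :: a) ^+ 2 <= c.
  have := hm (e a); rewrite (multishiftE hW) nrmZr ?(weight_ge0 hW)// !nrm_basis !mulr1 => h.
  apply: le_trans (_ : m ^+ 2 <= _); last by rewrite lerDl.
  by rewrite lerXn2r ?nnegrE ?(weight_ge0 hW).
have SE a : S (e (i :: a)) = (mu (i :: a))%:C *: e a.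
  apply: basis_ext => b; rewrite (is_adjointC adj) (multishiftE hW) innerZr_real innerZl !he.1.
  by rewrite eqseq_cons eqxx/=; case: eqP => [->|]; rewrite ?mulr0.
have S0 a : (if a is j :: _ then j != i else true) -> S (e a) = 0.
  move=> ai; apply: basis_ext => b.
  rewrite (is_adjointC adj) (multishiftE hW) innerZr_real he.1 inner0l.
  by case: a ai => [|j a] ji; rewrite ?mulr0//; rewrite eqseq_cons (negPf ji) mulr0.
pose g a := if a is j :: _ then (if j == i then 1 - mu a ^+ 2 / c else 1) else 1.
exists ((-1) *: (c^-1%:C *: (W i \o S)) + idfun), g; split.
- apply: (cstar_linear cA); last exact: cstar_id.
  by apply: (cstar_scale cA); apply: (cstar_comp cA) => //; exact: gen_mem.
- move=> x; rewrite !fctE scaleN1r addrC.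
  by apply: (adjoint_contraction adj c0 _ m0 hm); rewrite lerDl.
- move=> a; rewrite !fctE scaleN1r addrC.
  case: a => [|j a]; first by rewrite S0// (lin0 lW) scaler0 subr0 scale1r.
  rewrite /g; case: eqP => [->|/eqP ji].
    rewrite SE (linZ lW) (multishiftE hW) !scalerA -!rcM.
    rewrite -[X in X - _]scale1r -scalerBl; congr (_ *: _).
    by rewrite rcB expr2 [in RHS]mulrC mulrA.
  by rewrite S0// (lin0 lW) scaler0 subr0 scale1r.
- case=> [|j a]; rewrite /g ?lexx ?ler01//; case: eqP => [->|]; rewrite ?lexx ?ler01//.
  rewrite subr_ge0 ler_pdivrMr// mul1r mu_le gerBl.
  by rewrite divr_ge0 ?sqr_ge0// ltW.
- split=> // a; rewrite /g eqxx gtrBl divr_gt0// exprn_gt0//; exact: weight_gt0.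
Qed.

(** Eigenvalues multiply within [[0, 1]], so a single factor below 1 is enough. With all letters in
    [s], every nonempty word gets an eigenvalue below 1. *)
Lemma diag_contraction (s : seq 'I_n) : exists (G : F -> F) (g : seq 'I_n -> R),
  [/\ A G, forall x, nrm (G x) <= nrm x, forall a, G (e a) = (g a)%:C *: e a,
      forall a, 0 <= g a <= 1 &
      g [::] = 1 /\ forall i a, i \in s -> g (i :: a) < 1].
Proof.
elim: s => [|i s [G [g [AG hG GE g01 [g0 gs]]]]].
  exists idfun, (fun=> 1); split => //; first exact: cstar_id.
  - by move=> a; rewrite scale1r.
  - by move=> a; rewrite lexx ler01.
have [D [d [AD hD DE d01 [d0 ds]]]] := diag_factor i.
exists (G \o D), (fun a => d a * g a); split.
- exact: (cstar_comp cA).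
- by move=> x; apply: le_trans (hG _) (hD _).
- by move=> a; rewrite /= DE (linZ (bounded_linear (cstar_bounded cA AG))) GE scalerA rcM.
- move=> a; have /andP[ga0 ga1] := g01 a; have /andP[da0 da1] := d01 a.
  by rewrite mulr_ge0// mulr_ile1.
- split=> [|j a]; first by rewrite g0 d0 mulr1.
  have /andP[ga0 ga1] := g01 (j :: a); have /andP[da0 da1] := d01 (j :: a).
  rewrite inE => /predU1P[->|js].
    by apply: le_lt_trans (ds a); rewrite ler_piMr//; case/andP: (d01 (i :: a)) (g01 (i :: a)) => + _ /andP[].
  by apply: le_lt_trans (gs _ a js); rewrite ler_piMl.
Qed.

(* The powers of a diagonal contraction whose eigenvalue is 1 on the vacuum
   vector only tend strongly to the vacuum projection. *)
Lemma vacuum_approx : exists T : nat -> F -> F,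
  [/\ forall k, A (T k), forall k x, nrm (T k x) <= nrm x &
      forall x, tends0 (fun k y => T k y - P [::] y) x].
Proof.
have [G [g [AG hG GE g01 [g0 gs]]]] := diag_contraction (enum 'I_n).
have AT k : A (iter k (fun T => G \o T) idfun).
  by elim: k => [|k IH]; [exact: cstar_id | exact: (cstar_comp cA)].
have hT k x : nrm (iter k (fun T => G \o T) idfun x) <= nrm x.
  by elim: k => [|k IH] //=; apply: le_trans (hG _) IH.
exists (fun k => iter k (fun T => G \o T) idfun); split => //.
have TE k a : iter k (fun T => G \o T) idfun (e a) = (g a ^+ k)%:C *: e a.
  elim: k => [|k IH]; first by rewrite expr0 scale1r.
  by rewrite /= IH (linZ (bounded_linear (cstar_bounded cA AG))) GE scalerA exprSr rcM.
apply: (@tends0_dense _ _ _ 2 (range e)).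
- move=> k a x y; rewrite (bounded_linear (cstar_bounded cA (AT k))) line_proj_linear.
  by rewrite scalerBr opprD addrACA.
- move=> k x; apply: le_trans (nrmD _ _) _; rewrite nrmN.
  by have := hT k x; have := line_proj_le x (nrm_basis [::]); lra.
- exact: he.2.
- move=> _ [a _ <-] r r0.
  case: a => [|i a].
    exists 0%N => k _; rewrite TE g0 expr1n scale1r /line_proj he.1 eqxx scale1r subrr.
    by rewrite nrm0 ltW.
  have /cvgrPdist_lt/(_ _ r0)[N _ hN] : (g (i :: a) ^+ k @[k --> \oo] --> (0 : R)).
    apply: cvg_expr; have /andP[ga0 _] := g01 (i :: a).
    by rewrite ger0_norm// gs// mem_enum.
  exists N => k /hN /=; rewrite sub0r normrN => h.
  have /andP[ga0 _] := g01 (i :: a).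
  rewrite TE /line_proj he.1 scale0r subr0 nrmZr ?exprn_ge0// nrm_basis mulr1.
  by apply: ltW; apply: le_lt_trans h; exact: ler_norm.
Qed.

(** Membership of [P [::]] itself in [A] is still open here. The operators [T k \o Y \o X] lie in
    [A] and converge in norm, as [X] is compact and [T k \o Y] tends strongly to [P [::] \o Y]. *)
Lemma vacuum_proj_compact X Y : A X -> compact_op X -> A Y -> A (P [::] \o Y \o X).
Proof.
move=> AX cX AY; have [T [AT hT T0]] := vacuum_approx.
have [bX bY] := (cstar_bounded cA AX, cstar_bounded cA AY).
have bP := bounded_line_proj (nrm_basis [::]).
apply: (cstar_closed cA); apply/opnorm_closureP; split.
  by apply: bounded_comp => //; apply: bounded_comp.
have /bounded_opP[lY [m m0 hm]] := bY.
have lTP k : linear (fun y => T k y - P [::] y).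
  move=> a x y; rewrite (bounded_linear (cstar_bounded cA (AT k))) line_proj_linear.
  by rewrite scalerBr opprD addrACA.
have lT' k : linear (fun x => T k (Y x) - P [::] (Y x)).
  by move=> a x y; rewrite lY lTP.
have hT' k x : nrm (T k (Y x) - P [::] (Y x)) <= (2 * m) * nrm x.
  apply: le_trans (nrmD _ _) _; rewrite nrmN.
  have := hT k (Y x); have := line_proj_le (Y x) (nrm_basis [::]); have := hm x; lra.
have T0' x : tends0 (fun k x => T k (Y x) - P [::] (Y x)) x by exact: T0.
move=> r r0; have [k hk] := tends0_compact lT' hT' T0' cX r0.
exists (T k \o Y \o X); last by move=> x; rewrite -nrmN opprB; exact: hk.
by apply: (cstar_comp cA) => //; apply: (cstar_comp cA).
Qed.

(** A nonzero matrix entry of [X] between [e a] and [e b] is moved to the vacuum by word operators.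
    The resulting [Z] has rank one, and a second limit, applied to its adjoint, gives a nonzero
    multiple of [P [::]]. *)
Lemma vacuum_proj_mem X x : A X -> compact_op X -> X x != 0 -> A (P [::]).
Proof.
move=> AX cX Xx.
have lX := bounded_linear (cstar_bounded cA AX).
have [a [b ab]] : exists a b, inner (X (e a)) (e b) != 0.
  apply: contrapT => h.
  have Xe a : X (e a) = 0.
    apply: basis_ext => b; rewrite inner0l; apply/eqP.
    by apply: contrapT => /negP h'; apply: h; exists a, b.
  have [X' _ adj] := adjoint_exists (cstar_bounded cA AX).
  move/eqP: Xx; apply; apply: basis_ext => b; rewrite adj inner0l.
  suff -> : X' (e b) = 0 by rewrite innerC inner0l conjc0.
  by apply: basis_ext => a; rewrite (is_adjointC adj) Xe inner0l innerC inner0l conjc0.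
have [S AS Se] := word_operator a.
have [S2 AS2 S2e] := word_operator b.
have [S2' bS2' adj2] := adjoint_exists (cstar_bounded cA AS2).
have AS2' := cstar_adjoint cA AS2 bS2' adj2.
have AZ := cstar_comp cA (vacuum_proj_compact AX cX AS2') AS.
set Z := _ \o S in AZ.
have [Z' bZ' adjZ] := adjoint_exists (cstar_bounded cA AZ).
have AZ' := cstar_adjoint cA AZ bZ' adjZ.
have lZ' := bounded_linear bZ'.
set z := Z' (e [::]).
(* [Z] takes its values on the vacuum line, so its adjoint factors through [P [::]] and is
   determined by [z]. *)
have Z'E x0 : Z' x0 = inner x0 (e [::]) *: z.
  rewrite -(linZ lZ') -/(line_proj (e [::]) x0); apply: inner_inj => y.
  by rewrite -!adjZ -line_proj_adjoint /Z /= line_projK ?nrm_basis.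
have z0 : inner z (e [::]) != 0.
  rewrite /z innerC conjc_eq0 -adjZ /Z /= Se /line_proj innerZl innerxx nrm_basis.
  by rewrite expr1n mulr1 (is_adjointC adj2) S2e.
have [T [AT hT T0]] := vacuum_approx.
have bP := bounded_line_proj (nrm_basis [::]).
(* [T k \o Z'] differs from the limit by a rank-one operator with vector [T k z - P [::] z], so
   convergence at [z] alone is norm convergence. *)
have AzP : A (inner z (e [::]) *: P [::]).
  apply: (cstar_closed cA); apply/opnorm_closureP; split.
    exact: (cstar_scale (bounded_ops_cstar F)).
  move=> r r0; have [k /(_ k (leqnn k)) hk] := T0 z r r0.
  exists (T k \o Z'); first exact: (cstar_comp cA).
  move=> y; rewrite /= Z'E (linZ (bounded_linear (cstar_bounded cA (AT k)))).
  rewrite !fctE /line_proj scalerA mulrC -scalerA -scalerBr nrmZ mulrC.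
  apply: ler_pM; rewrite ?nrm_ge0//.
  - by have := normr_ge0 (inner y (e [::])); rewrite lecE => /andP[].
  - by rewrite -nrmN opprB.
  - by have := line_proj_le y (nrm_basis [::]); rewrite /line_proj nrmZ nrm_basis mulr1.
by have := cstar_scale cA (inner z (e [::]))^-1 AzP; rewrite scalerA mulVf// scale1r.
Qed.

(** All basis projections lie in the ideal generated by the vacuum projection: [S] sends the vacuum
    to [e a], and [S'] is its adjoint. *)
Lemma basis_proj_factor a : A (P [::]) ->
  exists S S', [/\ A S, A S' & P a = S \o P [::] \o S'].
Proof.
move=> AP; have [S AS Se] := word_operator a.
have [S' bS' adj] := adjoint_exists (cstar_bounded cA AS).
exists S, S'; split => //; first exact: (cstar_adjoint cA AS bS' adj).
apply: funext => x; rewrite /= /line_proj (linZ (bounded_linear (cstar_bounded cA AS))) Se.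
by rewrite (is_adjointC adj) Se.
Qed.

End WeightedShift.

(** * Representations not of Cuntz type *)

Section Representation.
Variables (R : realType) (n : nat) (F : hilbertType R) (e : seq 'I_n -> F).
Variables (mu : seq 'I_n -> R) (W : 'I_n -> F -> F).
Hypotheses (he : orthonormal_basis e) (hW : weighted_left_multishift e mu W).
Hypothesis hWinj : injective_multishift W.
Variables (K : hilbertType R) (pi : (F -> F) -> (K -> K)).
Hypothesis hpi : unital_star_representation (cstar_generated W) pi.

Local Notation A := (cstar_generated W).
Local Notation P := (fun a => line_proj (e a)).

Let cA : unital_cstar_subalgebra A := shift_cstar hW.
Let pi_linear T (AT : A T) : linear (pi T) :=
  bounded_linear (star_hom_bounded hpi.1 AT).

(** Otherwise [wold_K0] would be the closure of the zero subspace. *)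
Lemma not_cuntz_witness : ~ cuntz_type A pi ->
  exists X k, [/\ A X, compact_op X & pi X k != 0].
Proof.
move=> hc; apply: contrapT => hX; apply: hc; rewrite /cuntz_type /wold_K0.
set G := [set v | _].
have G0 : lspan G `<=` [set 0].
  move=> y; apply; split=> [|v [X [AX cX [k ->]]]].
    by split=> // a u v /= -> ->; rewrite scaler0 addr0.
  by apply/eqP; apply: contrapT => /negP h; apply: hX; exists X, k.
apply/seteqP; split=> x.
  move=> /in_closure cx; apply/nrm_eq0/eqP.
  rewrite eq_le nrm_ge0 andbT leNgt; apply/negP => /cx[y /G0 ->].
  by rewrite subr0 ltxx.
by move=> ->; apply: subset_closure => B [[]].
Qed.

(* If pi killed the vacuum projection it would kill every basis projection, so
   that pi X = pi (X_k) for the truncations X_k of a compact X, which tend to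
   0 in norm. *)
Lemma rep_vacuum_fixed X k : A X -> compact_op X -> pi X k != 0 ->
  A (P [::]) /\ exists2 v, v != 0 & pi (P [::]) v = v.
Proof.
move=> AX cX Xk.
have AP : A (P [::]).
  have [x Xx] : exists x, X x != 0.
    apply: contrapT => h; move/eqP: Xk; apply.
    have X0 x : nrm (X x) <= 0 * nrm x.
      rewrite mul0r; suff -> : X x = 0 by rewrite nrm0.
      by apply/eqP; apply: contrapT => /negP h'; apply: h; exists x.
    have := rep_bound cA hpi AX (lexx 0) X0 k; rewrite mulr0 mul0r => h0.
    by apply/nrm_eq0/eqP; rewrite eq_le h0 nrm_ge0.
  exact: (vacuum_proj_mem he hW hWinj AX cX Xx).
split=> //; apply: contrapT => noV.
(* A nonzero vector in the range of the idempotent [pi (P [::])] would be fixed by it. *)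
have piP0 v : pi (P [::]) v = 0.
  apply/eqP; apply: contrapT => /negP h; apply: noV; exists (pi (P [::]) v) => //.
  rewrite -[LHS]/((pi (P [::]) \o pi (P [::])) v) -(rep_comp hpi)//.
  by congr (pi _ v); apply: funext => x; rewrite /= line_projK ?nrm_basis.
have AP' a : A (P a).
  have [S [S' [AS AS' ->]]] := basis_proj_factor he hW hWinj a AP.
  by apply: (cstar_comp cA) => //; apply: (cstar_comp cA).
have piP a v : pi (P a) v = 0.
  have [S [S' [AS AS' ->]]] := basis_proj_factor he hW hWinj a AP.
  rewrite (rep_comp hpi)//; last exact: (cstar_comp cA).
  by rewrite (rep_comp hpi)//= piP0 (lin0 (pi_linear AS)).
(* Basis vectors are removed one at a time along a numbering of the words; a number coding no word
   gives the identity. *)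
pose D m := if pickle_inv m is Some a then (-1) *: P a + idfun else @idfun F.
have AD m : A (D m).
  rewrite /D; case: pickle_inv => [a|]; last exact: (cstar_id cA).
  by apply: (cstar_linear cA) => //; exact: (cstar_id cA).
have hD m x : nrm (D m x) <= nrm x.
  rewrite /D; case: pickle_inv => [a|] //.
  by rewrite !fctE scaleN1r addrC line_projC_le// nrm_basis.
have piD m v : pi (D m) v = v.
  rewrite /D; case: pickle_inv => [a|]; last by rewrite hpi.2.
  have [_ ->] := rep_sub cA hpi (AP' a) (cstar_id cA).
  by rewrite hpi.2 piP subr0.
have De m a : D m (e a) = if pickle_inv m == Some a then 0 else e a.
  rewrite /D; case: pickle_inv => [b|] //.
  rewrite !fctE scaleN1r addrC /line_proj he.1 -[_ == Some a]/(b == a) eq_sym.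
  by case: eqP => [->|]; rewrite ?scale1r ?subrr// scale0r subr0.
(* [T m] removes the words with code below [m]: it tends strongly to 0, although [pi (T m)] is the
   identity. *)
pose T := fix T m := if m is m'.+1 then D m' \o T m' else @idfun F.
have AT m : A (T m).
  by elim: m => [|m IH]; [exact: (cstar_id cA) | exact: (cstar_comp cA)].
have hT m x : nrm (T m x) <= 1 * nrm x.
  by rewrite mul1r; elim: m => [|m IH] //=; apply: le_trans (hD _ _) IH.
have piT m v : pi (T m) v = v.
  elim: m => [|m IH]; first by rewrite hpi.2.
  by rewrite -[T m.+1]/(D m \o T m) (rep_comp hpi)//= IH piD.
have lT m : linear (T m) := bounded_linear (cstar_bounded cA (AT m)).
have Te m a : T m (e a) = if (pickle a < m)%N then 0 else e a.
  elim: m => [|m IH] //=; rewrite IH ltnS.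
  case: (ltngtP (pickle a) m) => [_|am|<-].
  - exact: (lin0 (bounded_linear (cstar_bounded cA (AD m)))).
  - rewrite De; case: eqP => // ma; have := @pickle_invK (seq 'I_n) m.
    by rewrite ma /= => am'; rewrite am' ltnn in am.
  - by rewrite De pickleK_inv eqxx.
have T0 : forall x, tends0 T x.
  apply: (tends0_dense lT hT he.2) => _ [a _ <-] r r0.
  by exists (pickle a).+1 => m am; rewrite Te am nrm0 ltW.
have : nrm (pi X k) <= 0.
  apply/ler_addgt0Pr => r r0; rewrite add0r.
  (* The 2 absorbs the constant of [rep_bound], and [nrm k + 1] the norm of [k]. *)
  have r1 : 0 < r / (2 * (nrm k + 1)) by rewrite divr_gt0// mulr_gt0// ltr_wpDl// nrm_ge0.
  have [m hm] := tends0_compact lT hT T0 cX r1.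
  have := rep_bound cA hpi (cstar_comp cA (AT m) AX) (ltW r1) hm k.
  rewrite (rep_comp hpi)//= piT => h; apply: le_trans h _.
  have -> : 2 * (r / (2 * (nrm k + 1))) * nrm k = (nrm k * r) / (nrm k + 1).
    by field; rewrite gt_eqF// ltr_wpDl// nrm_ge0.
  rewrite ler_pdivrMr ?ltr_wpDl ?nrm_ge0//; have := nrm_ge0 k; nra.
by move=> h; move/eqP: Xk; apply; apply/nrm_eq0/eqP; rewrite eq_le h nrm_ge0.
Qed.

(** * Lower bound on the representation, and its image *)

Section LowerBound.
Variable v : K.
Hypotheses (AP : A (P [::])) (v0 : v != 0) (vP : pi (P [::]) v = v).

(* The compression P S^* S P equals |S e_0|^2 P, where P is the vacuum projection. *)
Lemma rep_vacuum_nrm S : A S -> nrm (pi S v) = nrm (S (e [::])) * nrm v.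
Proof.
move=> AS; have [S' bS' adj] := adjoint_exists (cstar_bounded cA AS).
have AS' := cstar_adjoint cA AS bS' adj.
have padj := star_hom_adjoint hpi.1 AS AS' adj.
have lPS : linear (S' \o S).
  exact: bounded_linear (bounded_comp bS' (cstar_bounded cA AS)).
have PSP : P [::] \o ((S' \o S) \o P [::]) = (nrm (S (e [::])) ^+ 2)%:C *: P [::].
  apply: funext => x; rewrite [LHS]/= !fctE /line_proj -[S' (S _)]/((S' \o S) _) (linZ lPS).
  by rewrite /= innerZl (is_adjointC adj) innerxx scalerA mulrC.
apply/eqP; rewrite -(@eqrXn2 _ 2) ?mulr_ge0 ?nrm_ge0// exprMn; apply/eqP.
have AQ : A ((S' \o S) \o P [::]) by apply: (cstar_comp cA) => //; exact: (cstar_comp cA).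
have adjP : is_adjoint (pi (P [::])) (pi (P [::])).
  exact: (star_hom_adjoint hpi.1 AP AP (@line_proj_adjoint _ _ _)).
rewrite -!ripxx (rip_adjoint _ _ padj) -{1}vP (rip_adjoint _ _ adjP) -{2}vP.
have -> : pi (P [::]) (pi S' (pi S (pi (P [::]) v))) =
   pi (P [::] \o ((S' \o S) \o P [::])) v.
  rewrite (rep_comp hpi)// (rep_comp hpi (cstar_comp cA AS' AS) AP) (rep_comp hpi)//.
by rewrite PSP (rep_scale cA hpi)// fctE vP ripC ripZl !ripxx.
Qed.

(** For [y = S e_0], [|T y| |v| = |pi (T S) v| <= M |pi S v| = M |y| |v|]. Such vectors contain the
    span of the basis, hence are dense. *)
Lemma rep_lower_bound T (M : R) : A T -> 0 <= M ->
  (forall w, nrm (pi T w) <= M * nrm w) -> forall x, nrm (T x) <= M * nrm x.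
Proof.
move=> AT M0 hM x; apply/ler_addgt0Pr => r r0.
have /bounded_opP[lT [m m0 hm]] := cstar_bounded cA AT.
(* [|T x|] is at most [m |x - y| + M (|x| + |x - y|)]; the 1 keeps the denominator positive. *)
have d0 : 0 < m + M + 1 by rewrite ltr_wpDl// addr_ge0.
have : closure (lspan (range e)) x by rewrite he.2.
move/in_closure => /(_ (r / (m + M + 1)))[|y ly xy]; first by rewrite divr_gt0.
have [S AS Sy] : exists2 S, A S & S (e [::]) = y.
  apply: (ly [set y | exists2 S, A S & S (e [::]) = y]).
  split=> [|_ [a _ <-]]; last exact: (word_operator he hW hWinj).
  split=> [|a u w [S AS <-] [S' AS' <-]].
    exists ((-1) *: idfun + idfun); last by rewrite !fctE scaleN1r addNr.
    by apply: (cstar_linear cA); exact: (cstar_id cA).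
  by exists (a *: S + S'); first exact: (cstar_linear cA).
have vgt : 0 < nrm v by rewrite lt_def nrm_ge0 andbT; apply: contra v0 => /eqP/nrm_eq0/eqP.
have hy : nrm (T y) <= M * nrm y.
  rewrite -(ler_pM2r vgt) -Sy -mulrA -(rep_vacuum_nrm AS) -[T (S _)]/((T \o S) _).
  by rewrite -rep_vacuum_nrm; [rewrite (rep_comp hpi)//=|exact: (cstar_comp cA)].
have h1 := nrmD (T (x - y)) (T y); rewrite -(linD lT) subrK in h1.
have h2 := nrmD (y - x) x; rewrite subrK -opprB nrmN in h2.
move: xy; rewrite ltr_pdivlMr// => xy.
have := hm (x - y); have := nrm_ge0 (x - y).
have := ler_wpM2l M0 h2; nra.
Qed.

(** The lower bound with [M = 0], applied to [T - S]. *)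
Lemma rep_inj : set_inj A pi.
Proof.
move=> S T /set_mem AS /set_mem AT ST.
have [AD DE] := rep_sub cA hpi AS AT.
apply: funext => x; apply/eqP; rewrite eq_sym -subr_eq0; apply/eqP/nrm_eq0/eqP.
rewrite eq_le nrm_ge0 andbT -(mul0r (nrm x)).
have := rep_lower_bound AD (lexx 0) _ x; rewrite !fctE scaleN1r addrC; apply.
by move=> w; rewrite DE ST subrr nrm0 mul0r.
Qed.

Local Notation B := (cstar_generated (fun i => pi (W i))).

Let cB : unital_cstar_subalgebra B :=
  cstar_generated_cstar
    (fun i => star_hom_bounded hpi.1 (@cstar_generated_gen _ _ _ W i)).

(** The [T] in [A] with [pi T] in [B] form a C*-algebra containing the generators; stability under
    norm limits comes from [rep_bound]. Membership in [A] is carried along because the laws of [pi]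
    hold on [A] only. *)
Lemma rep_image : set_fun A B pi.
Proof.
move=> T AT; suff [] : A T /\ B (pi T) by [].
apply: (AT [set T | A T /\ B (pi T)]); split; last first.
  move=> _ [i _ <-]; split; first exact: cstar_generated_gen.
  exact: (@cstar_generated_gen _ _ _ (fun i => pi (W i))).
split => /=.
- by move=> S [AS _]; exact: (cstar_bounded cA).
- by split; [exact: (cstar_id cA) | rewrite hpi.2; exact: (cstar_id cB)].
- move=> a S S' [AS BS] [AS' BS']; split; first exact: (cstar_linear cA).
  by rewrite (star_hom_linear hpi.1)//; exact: (cstar_linear cB).
- move=> S S' [AS BS] [AS' BS']; split; first exact: (cstar_comp cA).
  by rewrite (rep_comp hpi)//; exact: (cstar_comp cB).
- move=> S S' [AS BS] bS' adj; have AS' := cstar_adjoint cA AS bS' adj.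
  split=> //; apply: (cstar_adjoint cB BS); first exact: (star_hom_bounded hpi.1).
  exact: (star_hom_adjoint hpi.1).
- move=> S /opnorm_closureP[bS hS].
  have AS : A S.
    by apply: (cstar_closed cA); apply/opnorm_closureP; split=> // r /hS[S' []]; exists S'.
  split=> //; apply: (cstar_closed cB); apply/opnorm_closureP.
  split; first exact: (star_hom_bounded hpi.1).
  (* Halving [r] compensates the factor 2 of [rep_bound]. *)
  move=> r r0; have [|S' [AS' BS'] hS'] := hS (r / 2); first by rewrite divr_gt0.
  exists (pi S') => // x.
  have [AD DE] := rep_sub cA hpi AS' AS.
  rewrite -DE; apply: le_trans (rep_bound cA hpi AD (m := r / 2) _ _ x) _.
  + by rewrite ltW// divr_gt0.
  + by move=> y; rewrite !fctE scaleN1r addrC.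
  + by rewrite mulrCA divff// mulr1.
Qed.

(* The lower bound lifts a norm approximation of an operator by elements of
   pi(A) to a norm Cauchy sequence in A; hence pi(A) is closed. *)
Lemma rep_surj : set_surj A B pi.
Proof.
(* By minimality of [B], it suffices that the image of [A] is a unital C*-algebra containing the
   generators. *)
move=> T BT; apply: (BT [set pi S | S in A]); split; last first.
  by move=> _ [i _ <-]; exists (W i) => //; exact: cstar_generated_gen.
split => /=.
- by move=> _ [S AS <-]; exact: (star_hom_bounded hpi.1).
- by exists idfun; [exact: (cstar_id cA) | exact: hpi.2].
- move=> a _ _ [S AS <-] [S' AS' <-]; exists (a *: S + S').
    exact: (cstar_linear cA).
  exact: (star_hom_linear hpi.1).
- move=> _ _ [S AS <-] [S' AS' <-]; exists (S \o S'); first exact: (cstar_comp cA).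
  exact: (rep_comp hpi).
- move=> _ Q [S AS <-] bQ adjQ.
  have [S' bS' adj] := adjoint_exists (cstar_bounded cA AS).
  have AS' := cstar_adjoint cA AS bS' adj.
  exists S' => //; apply: is_adjoint_unique adjQ.
  exact: (star_hom_adjoint hpi.1).
- move=> Q /opnorm_closureP[bQ hQ].
  have pow0 k : 0 < 2^-1 ^+ k :> R by rewrite exprn_gt0// invr_gt0.
  have /choice[S hS] : forall k, exists S, A S /\
      forall x, nrm (Q x - pi S x) <= 2^-1 ^+ k * nrm x.
    by move=> k; have [_ [S AS <-] hS] := hQ _ (pow0 k); exists S.
  have AS k : A (S k) := (hS k).1.
  (* The constant 2 majorises [2^-k + 2^-(k+1)], carried back from the image to [A] by the lower
     bound. *)
  have [|L bL hL] := @operator_limit _ _ S 2 (fun k => cstar_bounded cA (AS k)).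
    move=> k x; have [AD DE] := rep_sub cA hpi (AS k) (AS k.+1).
    have p0 := ltW (pow0 k).
    have := @rep_lower_bound _ (2 * 2^-1 ^+ k) AD _ _ x.
    rewrite !fctE scaleN1r addrC; apply; first by rewrite mulr_ge0.
    move=> w; rewrite DE.
    have h1 := (hS k).2 w; have h2 := (hS k.+1).2 w.
    rewrite exprS in h2; rewrite -nrmN opprB in h2.
    have := nrmD (pi (S k.+1) w - Q w) (Q w - pi (S k) w).
    rewrite addrA subrK; have := mulr_ge0 p0 (nrm_ge0 w); lra.
  have AL : A L.
    apply: (cstar_closed cA); apply/opnorm_closureP; split=> // r r0.
    have [k hk] := geometric_lt (2 * 2) r0.
    exists (S k) => // x; apply: le_trans (hL k x) _.
    by rewrite ler_wpM2r ?nrm_ge0// ltW.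
  exists L => //; apply: funext => x; apply/eqP; rewrite -subr_eq0; apply/eqP/nrm_eq0/eqP.
  rewrite eq_le nrm_ge0 andbT.
  (* Here 9 is 8, from [rep_bound] at [L - S k], plus 1 from the choice of [S k]. *)
  apply: (@geometric_le0 _ (9 * nrm x)) => k.
  have [AD DE] := rep_sub cA hpi (AS k) AL.
  have h1 : nrm (pi L x - pi (S k) x) <= 2 * (2 * 2 * 2^-1 ^+ k) * nrm x.
    rewrite -DE; apply: (rep_bound cA hpi AD) => [|y].
      by rewrite mulr_ge0// ltW.
    by rewrite !fctE scaleN1r addrC.
  have h2 := (hS k).2 x; rewrite -opprB nrmN in h2.
  have := nrmD (pi L x - pi (S k) x) (pi (S k) x - Q x).
  by rewrite addrA subrK; nra.
Qed.

End LowerBound.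
End Representation.

Theorem theorem1p17 (R : realType) (n : nat) (hn : (0 < n)%N)
    (F : hilbertType R) (e : seq 'I_n -> F) (he : orthonormal_basis e)
    (mu : seq 'I_n -> R) (W : 'I_n -> F -> F)
    (hW : weighted_left_multishift e mu W) (hWinj : injective_multishift W)
    (K : hilbertType R) (hK : separable_space K)
    (pi : (F -> F) -> (K -> K))
    (hpi : unital_star_representation (cstar_generated W) pi)
    (hcuntz : ~ cuntz_type (cstar_generated W) pi) :
  star_isomorphic (cstar_generated W)
    (cstar_generated (fun i : 'I_n => pi (W i))).
Proof.
have [X [k [AX cX Xk]]] := not_cuntz_witness hcuntz.
have [AP [v v0 vP]] := rep_vacuum_fixed he hW hWinj hpi AX cX Xk.
exists pi; split; first exact: hpi.1.
split.
- exact: (rep_image hW hpi).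
- exact: (rep_inj he hW hWinj hpi AP v0 vP).
- exact: (rep_surj he hW hWinj hpi AP v0 vP).
Qed.
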